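(* Let $\mathbb{V}$ be an $n$-dimensional vector space ($n\ge 1$) over a finite field $\mathbb{F}$ with $q$ elements, with basis $\{\alpha_1,\ldots,\alpha_n\}$, and let $\Gamma(\mathbb{V})$ be its non-zero component graph with respect to this basis. Then the order (number of vertices) of $\Gamma(\mathbb{V})$ is $q^n-1$ and the size (number of edges) $m$ of $\Gamma(\mathbb{V})$ is $$m=\dfrac{q^{2n}-q^n+1-(2q-1)^n}{2}.$$
   Context: Let $\theta$ be the null vector of $\mathbb{V}$. Every $\mathbf{a}\in\mathbb{V}$ is written uniquely as $\mathbf{a}=a_1\alpha_1+\cdots+a_n\alpha_n$. The non-zero component graph $\Gamma(\mathbb{V})$ with respect to the basis $\{\alpha_1,\ldots,\alpha_n\}$ is the simple graph with vertex set $\mathbb{V}\setminus\{\theta\}$ in which two distinct vertices $\mathbf{a},\mathbf{b}$ are adjacent if and only if there is at least one $i$ such that the coefficients of $\alpha_i$ in $\mathbf{a}$ and in $\mathbf{b}$ are both non-zero. *)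

(* Defs.v *)
From HB Require Import structures.
From mathcomp Require Import all_boot all_order all_algebra all_field.

Set Implicit Arguments.
Unset Strict Implicit.
Unset Printing Implicit Defensive.

Import GRing.Theory.
Local Open Scope ring_scope.

Record simple_graph := SimpleGraph {
  vertex :> finType;
  adj : rel vertex;
  adj_sym : symmetric adj;
  adj_irr : irreflexive adj
}.

Definition graph_order (G : simple_graph) : nat := #|G|.

(* Edges are unordered pairs, so each edge is counted once in the size. *)
Definition edges (G : simple_graph) : {set {set G}} :=
  [set [set x; y] | x in G, y in G & adj x y].

Definition graph_size (G : simple_graph) : nat := #|edges G|.

Section NonZeroComponentGraph.

Variables (F : finFieldType) (V : vectType F) (n : nat) (alpha : n.-tuple V).

(* finvect_type V is V itself, with the finType structure that it inherits
   from the finite field F. *)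
Definition nonnull : finType := {v : finvect_type V | v != 0}.

(* When alpha is a basis, coord alpha i v is the coefficient of alpha_i in v. *)
Definition share_component (a b : V) : bool :=
  [exists i : 'I_n, (coord alpha i a != 0) && (coord alpha i b != 0)].

Definition nzc_adj : rel nonnull :=
  [rel a b : nonnull | (a != b) && share_component (val a) (val b)].

Lemma nzc_adj_sym : symmetric nzc_adj.
Proof.
move=> a b; rewrite /nzc_adj /= eq_sym; congr (_ && _).
by apply: eq_existsb => i; rewrite andbC.
Qed.

Lemma nzc_adj_irr : irreflexive nzc_adj.
Proof. by move=> a; rewrite /nzc_adj /= eqxx. Qed.

Definition nzc_graph : simple_graph := SimpleGraph nzc_adj_sym nzc_adj_irr.

End NonZeroComponentGraph.

(* Main.v *)
Require Import Defs.
From mathcomp Require Import all_boot all_order all_algebra all_field.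
From mathcomp Require Import zify ring.

Import GRing.Theory.
Local Open Scope ring_scope.

(** Both counts are counts of coordinate vectors.  For the size, count the
    ordered pairs of adjacent vertices, which is twice the number of edges
    ([card_adjacent_pairs]).  An ordered pair of vectors (a, b) has no basis
    vector in common exactly when, at each of the n positions, one of the two
    coefficients vanishes; that leaves q^2 - (q - 1)^2 = 2q - 1 choices of a
    pair of coefficients per position, hence (2q - 1)^n such pairs
    ([card_disjoint_support]).  The other q^(2n) - (2q - 1)^n pairs consist of
    non-null vectors, and they are the adjacent pairs together with the q^n - 1
    diagonal pairs (a, a) with a non-null, since a vector shares a component
    with itself as soon as it is non-null ([card_share_component]).  Therefore
    2m + (q^n - 1) + (2q - 1)^n = q^(2n). *)

(** Writing the edge set as the image of one set of ordered pairs lets that set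
    be counted fibre by fibre over the edges. *)
Lemma edgesE (G : simple_graph) :
  edges G = [set [set p.1; p.2] | p in [pred p : G * G | adj p.1 p.2]].
Proof.
apply/setP => e; apply/imset2P/imsetP => [[x y _]|[[x y] xy ->]].
  by rewrite inE => /andP[_ xy] ->; exists (x, y).
by exists x y => //; rewrite inE.
Qed.

(** Handshake identity: the unordered pair {x, y} comes from the two distinct
    ordered pairs (x, y) and (y, x). *)
Lemma card_adjacent_pairs (G : simple_graph) :
  #|[pred p : G * G | adj p.1 p.2]| = (2 * graph_size G)%N.
Proof.
rewrite -sum1_card (partition_big_imset (fun p : G * G => [set p.1; p.2])) /=.
rewrite /graph_size edgesE mulnC -sum_nat_const.
apply: eq_bigr => e /imsetP[[x y] xy ->] /=; rewrite inE /= in xy.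
have x'y : x != y by apply: contraTneq xy => ->; rewrite adj_irr.
rewrite sum1_card (eq_card (B := [set (x, y); (y, x)])) ?cards2.
  by rewrite xpair_eqE negb_and x'y.
move=> [u v]; rewrite !inE !xpair_eqE; apply/andP/idP => [[uv /eqP euv]|].
  rewrite inE /= in uv.
  have u'v : u != v by apply: contraTneq uv => ->; rewrite adj_irr.
  have: u \in [set x; y] by rewrite -euv !inE eqxx.
  have: v \in [set x; y] by rewrite -euv !inE eqxx orbT.
  rewrite !inE => /orP[] /eqP ev /orP[] /eqP eu; move: u'v;
  by rewrite ev eu !eqxx ?orbT.
by case/orP=> /andP[/eqP-> /eqP->]; rewrite inE /= ?[adj y x]adj_sym ?[[set y; x]]setUC.
Qed.

Section Coordinates.

Set Implicit Arguments.
Unset Strict Implicit.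

Variables (F : finFieldType) (V : vectType F) (n : nat) (alpha : n.-tuple V).
Hypotheses (dimV : \dim {:V} = n) (basis_alpha : basis_of {:V} alpha).

Local Notation W := (finvect_type V).

Lemma coord_inj (a b : V) : (forall i, coord alpha i a = coord alpha i b) -> a = b.
Proof.
move=> eq_ab; rewrite (coord_basis basis_alpha (memvf a)).
rewrite (coord_basis basis_alpha (memvf b)).
by apply: eq_bigr => i _; rewrite eq_ab.
Qed.

Lemma share_component_refl (a : V) : share_component alpha a a = (a != 0).
Proof.
apply/existsP/idP => [[i /andP[+ _]]|].
  by apply: contraNneq => ->; rewrite linear0.
move=> a0; apply/existsP; apply: contraNT a0 => /existsPn no_i.
apply/eqP/coord_inj => i; rewrite linear0; apply/eqP.
by have := no_i i; rewrite andbb negbK.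
Qed.

Lemma share_component_neq0 (a b : V) :
  share_component alpha a b -> (a != 0) && (b != 0).
Proof.
case/existsP=> i /andP[ai bi].
by apply/andP; split; [move: ai | move: bi]; apply: contraNneq => ->; rewrite linear0.
Qed.

Lemma card_finvect : #|{: W}| = (#|F| ^ n)%N.
Proof.
rewrite -(card_vspacef (Vector.class (W : vectType F))) card_vspace.
by congr (_ ^ _)%N.
Qed.

Definition coord_pair (p : W * W) : {ffun 'I_n -> F * F} :=
  [ffun i => (coord alpha i (p.1 : V), coord alpha i (p.2 : V))].

Lemma coord_pair_bij : bijective coord_pair.
Proof.
apply: inj_card_bij => [[a b] [c d] /ffunP eq_p|].
  congr (_, _); apply: coord_inj => i;
  by have := eq_p i; rewrite !ffunE => -[].
by rewrite card_ffun !card_prod card_finvect card_ord expnMn.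
Qed.

(** The complement consists of the (q - 1)^2 pairs of non-zero scalars. *)
Lemma card_zero_product_pairs :
  #|[pred z : F * F | (z.1 == 0) || (z.2 == 0)]| = (2 * #|F| - 1)%N.
Proof.
set Z := [pred z | _].
have cardZ : (#|Z| + #|F|.-1 * #|F|.-1 = #|F| * #|F|)%N.
  rewrite -card_prod -(cardC Z) -(cardC1 0) -cardX; congr (_ + _)%N.
  by apply: eq_card => -[x y]; rewrite !inE negb_or.
have : (0 < #|F|)%N by apply/card_gt0P; exists 0.
move: cardZ; case: #|F| => // k; lia.
Qed.

(** Under the coordinate bijection these pairs of vectors become the functions
    from positions to pairs of scalars, at least one of which is zero, so the
    choices at the n positions are independent. *)
Lemma card_disjoint_support :
  #|[pred p : W * W | ~~ share_component alpha p.1 p.2]| = ((2 * #|F| - 1) ^ n)%N.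
Proof.
rewrite -card_zero_product_pairs -[in RHS](card_ord n) -card_ffun_on.
rewrite -(on_card_preimset (onW_bij _ coord_pair_bij)).
apply: eq_card => p; rewrite !inE negb_exists.
apply/forallP/ffun_onP => [dis i|dis i].
  by have := dis i; rewrite ffunE inE negb_and !negbK.
by have := dis i; rewrite ffunE inE negb_and !negbK.
Qed.

Lemma card_nonnull : #|nonnull V| = (#|F| ^ n - 1)%N.
Proof. by rewrite card_sig subn1 -card_finvect -(cardC1 (0 : W)). Qed.

(** Both members of a pair that shares a component are non-null, so such a pair
    is a pair of vertices: an adjacent one, or a diagonal one. *)
Lemma card_share_component :
  #|[pred p : W * W | share_component alpha p.1 p.2]| =
  (#|[pred p : nonnull V * nonnull V | nzc_adj alpha p.1 p.2]|
   + #|nonnull V|)%N.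
Proof.
set S := [pred p | _]; rewrite -(cardID [pred p : W * W | p.1 == p.2] S) addnC.
congr (_ + _)%N.
  have val2_inj : injective (fun p : nonnull V * nonnull V => (val p.1, val p.2)).
    by move=> [a b] [c d] [/val_inj-> /val_inj->].
  rewrite -(card_imset _ val2_inj); apply: eq_card => -[a b].
  apply/idP/imsetP => [|[[c d] + [-> ->]]].
    rewrite !inE /= => /andP[ab sab]; have /andP[a0 b0] := share_component_neq0 sab.
    by exists (Sub a a0, Sub b b0) => //; apply/andP.
  by rewrite !inE.
have diag_inj : injective (fun a : nonnull V => (val a, val a)).
  by move=> a b [/val_inj].
rewrite -(card_imset _ diag_inj); apply: eq_card => -[a b].
apply/idP/imsetP => [|[c _ [-> ->]]].
  rewrite !inE /= => /andP[sab /eqP eab]; rewrite -eab share_component_refl in sab *.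
  by exists (Sub a sab).
by rewrite !inE /= eqxx share_component_refl (valP c).
Qed.

End Coordinates.

Theorem theorem3p6 (F : finFieldType) (V : vectType F) (n q : nat)
    (alpha : n.-tuple V)
    (n_ge1 : (1 <= n)%N)
    (cardF : #|F| = q)
    (dimV : \dim {:V} = n)
    (basis_alpha : basis_of {:V} alpha) :
  graph_order (nzc_graph alpha) = (q ^ n - 1)%N /\
  (graph_size (nzc_graph alpha))%:R =
    (q%:R ^+ (2 * n) - q%:R ^+ n + 1 - (2 * q%:R - 1) ^+ n) / 2 :> rat.
Proof.
have order : #|nonnull V| = (q ^ n - 1)%N by rewrite (card_nonnull dimV) cardF.
split=> //.
have q_gt0 : (0 < q)%N by rewrite -cardF; apply/card_gt0P; exists 0.
have count : (2 * graph_size (nzc_graph alpha) + q ^ n + (2 * q - 1) ^ n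
              = q ^ (2 * n) + 1)%N.
  have := cardC [pred p : finvect_type V * finvect_type V
                | share_component alpha p.1 p.2].
  rewrite (card_share_component basis_alpha) card_prod (card_finvect dimV).
  rewrite (card_disjoint_support dimV basis_alpha) order cardF.
  rewrite (card_adjacent_pairs (nzc_graph alpha)) [(2 * n)%N]mulnC expnM -mulnn.
  by have : (0 < q ^ n)%N; [rewrite expn_gt0 q_gt0 | lia].
have := congr1 (fun k => k%:R : rat) count.
rewrite /= natrD natrD natrM (natrD _ (q ^ _)) !natrX natrB; last by rewrite muln_gt0.
rewrite natrM => countQ.
have -> : (q%:R ^+ (2 * n) : rat) =
    2 * (graph_size (nzc_graph alpha))%:R + q%:R ^+ n + (2 * q%:R - 1) ^+ n - 1.
  by rewrite countQ addrK.
by field.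
Qed.
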